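(* Let $\mathcal Y$ be an AM-space with unit $\mathbf 1$ and suppose that there exist $u_0\in\operatorname{dom}(\mathcal J)$, $v_0\in\operatorname{dom}(\mathcal H(\cdot\mid f))$ and a constant $\varepsilon>0$ such that $A^lu_0+\varepsilon\mathbf 1\le v_0\le A^uu_0-\varepsilon\mathbf 1$. Then there exists a solution $\mu$ of the dual problem $$\sup_{\mu\in\mathcal Y^*\times\mathcal Y^*,\ \mu\ge0}\ -\frac1\alpha\mathcal H^*(\alpha E^*\mu\mid f)-\mathcal J^*(-B^*\mu)$$ and there is no duality gap, i.e. $$\frac1\alpha\mathcal H(v\mid f)+\mathcal J(u)=-\frac1\alpha\mathcal H^*(\alpha E^*\mu\mid f)-\mathcal J^*(-B^*\mu),$$ where $(u,v)$ is an optimal solution of the primal problem $$\min_{u\in\mathcal X,\ v\in\mathcal Y,\ Bu\le Ev}\ \frac1\alpha\mathcal H(v\mid f)+\mathcal J(u).$$ Moreover, $\mu$ is a Lagrange multiplier for the constraint $Bu\le Ev$ in the primal problem and the complementarity condition $\langle\mu,Bu-Ev\rangle=0$ holds.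
   Context: $\mathcal X=\mathcal U^*$ and $\mathcal Y=\mathcal V^*$ are duals of Banach lattices with the dual norm and dual partial order ($y\ge0$ iff $\langle y,v\rangle\ge0$ for all $v\in\mathcal V$, $v\ge0$). $A^l,A^u:\mathcal X\to\mathcal Y$ are bounded linear operators, $f\in\mathcal Y$ and $\alpha>0$ are fixed. $\mathcal J:\mathcal X\to[0,+\infty]$ and $\mathcal H(\cdot\mid f):\mathcal Y\to[0,+\infty]$ are proper, convex and weakly-* lower semicontinuous. $Bu=(A^lu,-A^uu)$ and $Ev=(v,-v)$ map into $\mathcal Y\times\mathcal Y$; orders on $\mathcal Y\times\mathcal Y$ and $\mathcal Y^*\times\mathcal Y^*$ are componentwise. $B^*,E^*$ are adjoints; $\mathcal J^*$ and $\mathcal H^*(\cdot\mid f)$ are convex conjugates (the latter in the first argument), defined on $\mathcal X^*$ and $\mathcal Y^*$. A Banach lattice $\mathcal Y$ is an AM-space if $\|x\vee y\|=\|x\|\vee\|y\|$ for all $x,y\ge0$; $\mathbf 1\in\mathcal Y$ is a unit if $\mathbf 1\ge0$, $\|\mathbf 1\|=1$ and $\|x\|\le1\Rightarrow|x|\le\mathbf 1$. That $\mu\ge0$ is a Lagrange multiplier means that a primal optimal $(u,v)$ minimises the Lagrangian $(u',v')\mapsto\frac1\alpha\mathcal H(v'\mid f)+\mathcal J(u')+\langle\mu,Bu'-Ev'\rangle$ over $\mathcal X\times\mathcal Y$ and $\langle\mu,Bu-Ev\rangle=0$. *)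

(* Defs.v *)
From HB Require Import structures.
From mathcomp Require Import all_boot all_order all_algebra.
From mathcomp Require Import all_classical all_reals all_analysis.

Set Implicit Arguments.
Unset Strict Implicit.
Unset Printing Implicit Defensive.

Import Order.TTheory GRing.Theory Num.Theory.
Import numFieldNormedType.Exports.

Local Open Scope classical_set_scope.
Local Open Scope ring_scope.

Section BoundedOperators.
Context {R : realType} (X Y : normedModType R).

Definition bounded_operator : {pred X -> Y} :=
  mem [set f : X -> Y | linear f /\
        exists C : R, forall x, `|f x| <= C * `|x|].

Record bop := Bop { bop_fun :> X -> Y ; bop_funP : bop_fun \in bounded_operator }.

HB.instance Definition _ := [isSub for bop_fun].
HB.instance Definition _ := [Choice of bop by <:].

Lemma bopP (f g : bop) : f =1 g -> f = g.
Proof. by move=> fg; apply/val_inj/funext. Qed.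

Lemma bop_linear (f : bop) : linear f.
Proof. by have := bop_funP f; rewrite inE => -[]. Qed.

HB.instance Definition _ (f : bop) :=
  GRing.isLinear.Build R X Y *:%R f (bop_linear f).

Lemma bop_bounded (f : bop) : exists C : R, forall x, `|f x| <= C * `|x|.
Proof. by have := bop_funP f; rewrite inE => -[]. Qed.

Lemma bounded_operator_submod : submod_closed bounded_operator.
Proof.
split=> [|a f g].
  rewrite inE; split=> [b x y|]; first by rewrite /= scaler0 addr0.
  by exists 0 => x; rewrite normr0 mul0r.
rewrite !inE => -[lf [C Cf]] [lg [D Dg]]; split=> [b x y|].
  rewrite -![(_ + g) _]/(a *: f _ + g _) lf lg !scalerDr !scalerA (mulrC b a).
  by rewrite addrACA.
exists (`|a| * C + D) => x; rewrite (le_trans (ler_normD _ _))//.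
by rewrite normrZ mulrDl lerD// -mulrA ler_wpM2l.
Qed.

HB.instance Definition _ :=
  GRing.isSubmodClosed.Build _ _ bounded_operator bounded_operator_submod.
HB.instance Definition _ := [SubChoice_isSubLmodule of bop by <:].

Definition op_norm (f : bop) : R := sup [set `|f x| | x in [set x | `|x| <= 1]].

Lemma op_norm_has_sup (f : bop) : has_sup [set `|f x| | x in [set x | `|x| <= 1]].
Proof.
split; first by exists `|f 0|, 0 => //=; rewrite normr0.
have [C Cf] := bop_bounded f; exists `|C| => _ [x /= x1 <-].
rewrite (le_trans (Cf x))// (@le_trans _ _ (`|C| * `|x|))//.
  by rewrite ler_wpM2r// ler_norm.
by rewrite ler_piMr.
Qed.

Lemma op_norm_ge0 (f : bop) : 0 <= op_norm f.
Proof.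
apply: le_trans (ub_le_sup (op_norm_has_sup f).2 _); last first.
  by exists 0 => //=; rewrite normr0.
by [].
Qed.

Lemma ler_op_norm (f : bop) x : `|f x| <= op_norm f * `|x|.
Proof.
have [->|x0] := eqVneq x 0; first by rewrite linear0 !normr0 mulr0.
have nx0 : 0 < `|x| by rewrite normr_gt0.
rewrite -ler_pdivrMr//; apply: (ub_le_sup (op_norm_has_sup f).2).
exists (`|x|^-1 *: x) => /=; first by rewrite normrZ normfV normr_id mulVf ?gt_eqF.
by rewrite linearZ/= normrZ normfV normr_id mulrC.
Qed.

Lemma op_norm_le (f : bop) c : (forall x, `|x| <= 1 -> `|f x| <= c) -> op_norm f <= c.
Proof.
move=> fc; apply: ge_sup; first exact: (op_norm_has_sup f).1.
by move=> _ [x /= x1 <-]; exact: fc.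
Qed.

Lemma op_normD (f g : bop) : op_norm (f + g) <= op_norm f + op_norm g.
Proof.
apply: op_norm_le => x x1; rewrite (le_trans (ler_normD _ _))// lerD//.
  by rewrite (le_trans (ler_op_norm _ _))// ler_piMr// op_norm_ge0.
by rewrite (le_trans (ler_op_norm _ _))// ler_piMr// op_norm_ge0.
Qed.

Lemma op_normZ (a : R) (f : bop) : op_norm (a *: f) = `|a| * op_norm f.
Proof.
have le b g : op_norm (b *: g) <= `|b| * op_norm g.
  apply: op_norm_le => x x1; rewrite normrZ ler_wpM2l//.
  by rewrite (le_trans (ler_op_norm _ _))// ler_piMr// op_norm_ge0.
apply/eqP; rewrite eq_le le/=.
have [->|a0] := eqVneq a 0; first by rewrite normr0 mul0r op_norm_ge0.
rewrite -ler_pdivlMl ?normr_gt0// -normfV.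
by have := le a^-1 (a *: f); rewrite scalerA mulVf// scale1r.
Qed.

Lemma op_norm_eq0 (f : bop) : op_norm f = 0 -> f = 0.
Proof.
move=> f0; apply: bopP => x; apply/eqP; rewrite -normr_eq0 eq_le normr_ge0 andbT.
by rewrite (le_trans (ler_op_norm f x))// f0 mul0r.
Qed.

HB.instance Definition _ :=
  Lmodule_isNormed.Build R bop op_normD op_normZ op_norm_eq0.

Lemma bop_normE (f : bop) : `|f| = sup [set `|f x| | x in [set x | `|x| <= 1]].
Proof. by []. Qed.

Lemma ler_bop_norm (f : bop) x : `|f x| <= `|f| * `|x|.
Proof. exact: ler_op_norm. Qed.

End BoundedOperators.

Section Completeness.
Context {R : realType} (X : normedModType R) (Y : completeNormedModType R).

Lemma bop_complete (F : set_system (bop X Y)) :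
  ProperFilter F -> cauchy F -> cvg F.
Proof.
move=> FF /cauchy_ballP Fc.
have Fcx x : cvg ((fun f : bop X Y => f x) @ F).
  apply: cauchy_cvg; apply/cauchy_ballP => e e0.
  have d0 : 0 < e / (`|x| + 1) by rewrite divr_gt0// ltr_wpDl.
  have := Fc _ d0; rewrite !near_simpl.
  case=> -[A B] [FA FB] AB; exists ((fun f : bop X Y => f x) @` A, (fun f : bop X Y => f x) @` B).
    by split; [apply: filterS FA|apply: filterS FB] => f Pf /=; exists f.
  move=> [_ _] /= [[f Af <-] [g Bg <-]].
  have := AB (f, g) (conj Af Bg).
  rewrite /= -!ball_normE /= => fg.
  rewrite -[f x - g x]/((f - g) x) (le_lt_trans (ler_op_norm _ _))//.
  have x0 := normr_ge0 x.
  rewrite -[op_norm _]/(`|f - g|).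
  rewrite (@le_lt_trans _ _ (`|f - g| * (`|x| + 1)))//.
    by rewrite ler_wpM2l// lerDl.
  by rewrite -ltr_pdivlMr// ltr_wpDl.
pose l x := lim ((fun f : bop X Y => f x) @ F).
have lin : linear l.
  move=> a x y; apply/cvg_lim => //.
  under eq_fun do rewrite linearP.
  by apply: cvgD; [apply: cvgZr|]; exact: Fcx.
have near_le (e : R) : 0 < e ->
    F [set f : bop X Y | forall x, `|f x - l x| <= e * `|x|].
  move=> e0; have := Fc _ e0.
  case=> -[A B] [FA FB] AB; apply: filterS FA => f Af x.
  have cv : (fun g : bop X Y => `|f x - g x|) @ F --> `|f x - l x|.
    by apply: cvg_norm; apply: cvgB; [exact: cvg_cst|exact: Fcx].
  rewrite -(cvg_lim _ cv)//; apply: limr_le; first by apply/cvg_ex; eexists; exact: cv.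
  apply: filterS FB => g Bg; rewrite -[f x - g x]/((f - g) x).
  rewrite (le_trans (ler_op_norm _ _))// ler_wpM2r//.
  have := AB (f, g) (conj Af Bg); rewrite /= -ball_normE/=.
  exact: ltW.
have lb : l \in @bounded_operator R X Y.
  rewrite inE; split=> //.
  have [f fl] := filter_ex (near_le _ (@ltr01 R)).
  exists (1 + `|f|) => x.
  rewrite -[l x](subrK (f x)) (le_trans (ler_normD _ _))// mulrDl lerD//.
    by rewrite distrC.
  exact: ler_op_norm.
apply/cvg_ex; exists (Bop lb); apply/cvgrPdist_le => e e0.
apply: filterS (near_le _ e0) => f fe; apply: op_norm_le => x x1.
change (`|l x - f x| <= e); rewrite distrC (le_trans (fe x))// ler_piMr//.
exact: ltW.
Qed.

HB.instance Definition _ := Uniform_isComplete.Build (bop X Y) bop_complete.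

End Completeness.

Reserved Notation "x <=v y" (at level 70, y at next level).

(* The order is a field of the mixin: the order and the algebraic hierarchies
   of the library only join below numeric domains, so a vector space cannot be
   equipped with an instance of Order.Lattice. *)
HB.mixin Record CompleteNormedModule_isBanachLattice (R : realType) V
    & CompleteNormedModule R V := {
  lv_le : rel V ;
  lv_join : V -> V -> V ;
  lv_meet : V -> V -> V ;
  lv_lexx : reflexive lv_le ;
  lv_le_anti : antisymmetric lv_le ;
  lv_le_trans : transitive lv_le ;
  lv_leUx : forall x y z, lv_le (lv_join x y) z = lv_le x z && lv_le y z ;
  lv_lexI : forall x y z, lv_le x (lv_meet y z) = lv_le x y && lv_le x z ;
  lv_leD2r : forall z x y : V, lv_le x y -> lv_le (x + z) (y + z) ;
  lv_leZ : forall (a : R) (x y : V), 0 <= a -> lv_le x y -> lv_le (a *: x) (a *: y) ;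
  lv_le_normr : forall x y : V,
    lv_le (lv_join x (- x)) (lv_join y (- y)) -> `|x| <= `|y|
}.

#[short(type="banachLatticeType")]
HB.structure Definition BanachLattice (R : realType) :=
  { V of CompleteNormedModule R V & CompleteNormedModule_isBanachLattice R V }.

Notation "x <=v y" := (lv_le x y) : ring_scope.

Arguments lv_leD2r {R s} z {x y}.
Arguments lv_leZ {R s a x y}.
Arguments lv_le_normr {R s x y}.

(* The lattice modulus |x| = x \/ -x, not to be confused with the norm `|x|. *)
Definition labs {R : realType} {V : banachLatticeType R} (x : V) : V :=
  lv_join x (- x).

Section BanachLatticeTheory.
Context {R : realType} {V : banachLatticeType R}.
Implicit Types (x y z w : V).

Lemma lv_le_transl y x z : x <=v y -> y <=v z -> x <=v z.
Proof. exact: lv_le_trans. Qed.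

Lemma lv_leUl x y : x <=v lv_join x y.
Proof. by have := lv_lexx (lv_join x y); rewrite lv_leUx => /andP[]. Qed.

Lemma lv_leUr x y : y <=v lv_join x y.
Proof. by have := lv_lexx (lv_join x y); rewrite lv_leUx => /andP[]. Qed.

Lemma lv_leIl x y : lv_meet x y <=v x.
Proof. by have := lv_lexx (lv_meet x y); rewrite lv_lexI => /andP[]. Qed.

Lemma lv_leIr x y : lv_meet x y <=v y.
Proof. by have := lv_lexx (lv_meet x y); rewrite lv_lexI => /andP[]. Qed.

Lemma lv_leD2rE z x y : (x + z <=v y + z) = (x <=v y).
Proof.
by apply/idP/idP => [/(lv_leD2r (- z))|]; [rewrite !addrK|exact: lv_leD2r].
Qed.

Lemma lv_subr_ge0 x y : (0 <=v y - x) = (x <=v y).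
Proof. by rewrite -(lv_leD2rE x) add0r subrK. Qed.

Lemma lv_leD x y z w : x <=v y -> z <=v w -> x + z <=v y + w.
Proof.
move=> xy zw; apply: (lv_le_transl (lv_leD2r z xy)).
by rewrite ![y + _]addrC; exact: lv_leD2r.
Qed.

Lemma lv_addr_ge0 x y : 0 <=v x -> 0 <=v y -> 0 <=v x + y.
Proof. by move=> x0 y0; rewrite -[0 in X in X <=v _]addr0 lv_leD. Qed.

Lemma lv_scaler_ge0 (a : R) x : 0 <= a -> 0 <=v x -> 0 <=v a *: x.
Proof. by move=> a0 x0; rewrite -[0 in X in X <=v _](scaler0 _ a) lv_leZ. Qed.

Lemma lv_leBl x y z : (x - y <=v z) = (x <=v z + y).
Proof. by rewrite -(lv_leD2rE y) subrK. Qed.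

Lemma lv_leBr x y z : (x <=v y - z) = (x + z <=v y).
Proof. by rewrite -(lv_leD2rE z) subrK. Qed.

Lemma lv_leN2 x y : (- x <=v - y) = (y <=v x).
Proof. by rewrite -lv_subr_ge0 opprK addrC lv_subr_ge0. Qed.

Definition lpos x : V := lv_join x 0.

Lemma lpos_ge0 x : 0 <=v lpos x. Proof. exact: lv_leUr. Qed.

Lemma lpos_ge x : x <=v lpos x. Proof. exact: lv_leUl. Qed.

Lemma lpos_le x y : (lpos x <=v y) = (x <=v y) && (0 <=v y).
Proof. exact: lv_leUx. Qed.

Lemma lposB x : lpos x - lpos (- x) = x.
Proof.
suff -> : lpos x = lpos (- x) + x by rewrite addrAC subrr add0r.
apply/lv_le_anti/andP; split.
  rewrite lpos_le -[X in X <=v _ + _]add0r lv_leD2rE lpos_ge0/=.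
  by rewrite -lv_leBl sub0r lpos_ge.
by rewrite -lv_leBr lpos_le lv_leBr addNr lpos_ge0 lv_leBr add0r lpos_ge.
Qed.

Lemma labs_ge0 x : 0 <=v labs x.
Proof.
have h : 0 <=v labs x + labs x.
  by rewrite -[X in X <=v _](subrr x) lv_leD ?lv_leUl ?lv_leUr.
have -> : labs x = (2^-1 : R) *: (labs x + labs x).
  by rewrite -(mulr2n (labs x)) -(scaler_nat 2 (labs x : V)) scalerA mulVf// scale1r.
by rewrite lv_scaler_ge0.
Qed.

Lemma labs_le x y : (labs x <=v y) = (x <=v y) && (- y <=v x).
Proof. by rewrite lv_leUx -(lv_leN2 x) opprK. Qed.

Lemma ge0_labs x : 0 <=v x -> labs x = x.
Proof.
move=> x0; apply/lv_le_anti/andP; split; last exact: lv_leUl.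
rewrite labs_le lv_lexx/= (lv_le_transl _ x0)//.
by rewrite -oppr0 lv_leN2.
Qed.

Lemma ler_norm_labs x y : labs x <=v y -> `|x| <= `|y|.
Proof.
by move=> xy; apply: lv_le_normr; apply: (lv_le_transl xy); exact: lv_leUl.
Qed.

Lemma norm_labs x : `|labs x| = `|x|.
Proof.
apply/le_anti/andP; split; last exact/ler_norm_labs/lv_lexx.
apply: lv_le_normr.
by rewrite -/(labs (labs x)) ge0_labs ?labs_ge0// lv_lexx.
Qed.

Lemma ler_norm_lpos x : `|lpos x| <= `|x|.
Proof.
rewrite -(norm_labs x) ler_norm_labs// ge0_labs ?lpos_ge0// lpos_le labs_ge0 andbT.
exact: lv_leUl.
Qed.

Lemma ler_norm_pos x y : 0 <=v x -> x <=v y -> `|x| <= `|y|.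
Proof. by move=> x0 xy; rewrite ler_norm_labs// ge0_labs. Qed.

Lemma labsE x : labs x = lpos x + lpos (- x).
Proof.
apply/lv_le_anti/andP; split.
  rewrite lv_leUx; apply/andP; split.
    by rewrite -[X in X <=v _]addr0 lv_leD ?lpos_ge0 ?lpos_ge.
  by rewrite -[X in X <=v _]add0r lv_leD ?lpos_ge0 ?lpos_ge.
have -> : lpos (- x) = lpos x - x.
  by rewrite -[X in _ = _ - X]lposB opprB addrC subrK.
rewrite addrA lv_leBl -lv_leBr lpos_le !lv_leBr add0r [x + _]addrC -!lv_leBr.
rewrite !lpos_le !lv_leBr !add0r; apply/andP; split; apply/andP; split.
- by rewrite lv_leD2rE lv_leUl.
- by rewrite -[X in X <=v _]add0r lv_leD2rE labs_ge0.
- by rewrite -[X in X <=v _]add0r lv_leD2rE labs_ge0.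
- by rewrite -lv_leBl sub0r lv_leUr.
Qed.

Lemma riesz_decomposition w x y :
  0 <=v w -> w <=v x + y -> 0 <=v x -> 0 <=v y ->
  exists z, [/\ 0 <=v z, z <=v x, 0 <=v w - z & w - z <=v y].
Proof.
move=> w0 wxy x0 y0; exists (lv_meet w x); split.
- by rewrite lv_lexI w0.
- exact: lv_leIr.
- by rewrite lv_subr_ge0 lv_leIl.
rewrite lv_leBl addrC -lv_leBl lv_lexI !lv_leBl wxy andbT.
by rewrite -[X in X <=v _]addr0 lv_leD// lv_lexx.
Qed.

End BanachLatticeTheory.

(* A positively homogeneous additive function on the positive cone extends
   linearly to the whole space. *)
Section ConeExtension.
Context {R : realType} {V : banachLatticeType R} (p : V -> R).
Hypothesis pD : forall x y, 0 <=v x -> 0 <=v y -> p (x + y) = p x + p y.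
Hypothesis pZ : forall a x, 0 <= a -> 0 <=v x -> p (a *: x) = a * p x.

Definition cone_ext (x : V) : R := p (lpos x) - p (lpos (- x)).

Lemma cone_extB x y : 0 <=v x -> 0 <=v y -> cone_ext (x - y) = p x - p y.
Proof.
move=> x0 y0; apply/eqP; rewrite /cone_ext subr_eq addrAC eq_sym subr_eq.
rewrite -!pD ?lpos_ge0//; apply/eqP; congr p.
have xE : lpos (x - y) - lpos (- (x - y)) + y = x by rewrite lposB subrK.
by rewrite -{1}xE addrAC subrK.
Qed.

Lemma cone_ext_pos x : 0 <=v x -> cone_ext x = p x.
Proof.
move=> x0; rewrite -{1}[x]subr0 cone_extB ?lv_lexx//.
have := @pZ 0 0 (lexx _) (lv_lexx _); rewrite scale0r mul0r => ->.
by rewrite subr0.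
Qed.

Lemma cone_ext_linear : linear (cone_ext : V -> R^o).
Proof.
have extD x y : cone_ext (x + y) = cone_ext x + cone_ext y.
  rewrite -{1}[x]lposB -{1}[y]lposB addrACA -opprD.
  by rewrite cone_extB ?pD ?lv_addr_ge0 ?lpos_ge0// opprD addrACA.
have extN x : cone_ext (- x) = - cone_ext x.
  by rewrite -{1}[x]lposB opprB cone_extB ?lpos_ge0// opprB.
have extZ a x : 0 <= a -> cone_ext (a *: x) = a * cone_ext x.
  move=> a0; rewrite -{1}[x]lposB scalerBr cone_extB ?lv_scaler_ge0 ?lpos_ge0//.
  by rewrite !pZ ?lpos_ge0// mulrBr.
move=> a x y; rewrite extD; congr (_ + _).
have [a0|a0] := leP 0 a; first exact: extZ.
rewrite -[a]opprK scaleNr extN extZ ?oppr_ge0 1?ltW// scaleNr.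
by rewrite /GRing.scale/= mulNr.
Qed.

End ConeExtension.

Definition dual {R : realType} (V : normedModType R) : Type := bop V R^o.
Identity Coercion dual_to_bop : dual >-> bop.

HB.instance Definition _ {R : realType} (V : normedModType R) :=
  CompleteNormedModule.on (dual V).

(* The dual lattice; its lattice operations are given by the
   Riesz-Kantorovich formula (f \/ 0)(v) = sup_(0 <= w <= v) f w, v >= 0. *)
Section DualLattice.
Context {R : realType} (V : banachLatticeType R).
Implicit Types (f g h : dual V) (v w : V).

Definition dual_le f g : bool := `[< forall v, 0 <=v v -> f v <= g v >].

Lemma dual_leP f g : reflect (forall v, 0 <=v v -> f v <= g v) (dual_le f g).
Proof. exact: asboolP. Qed.

Lemma dual_le_refl : reflexive dual_le.
Proof. by move=> f; apply/dual_leP. Qed.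

Lemma dual_le_anti : antisymmetric dual_le.
Proof.
move=> f g /andP[/dual_leP fg /dual_leP gf]; apply: bopP => v.
have pos w : 0 <=v w -> f w = g w.
  by move=> w0; apply/eqP; rewrite eq_le fg// gf.
by rewrite -[v]lposB !linearB/= !pos ?lpos_ge0.
Qed.

Lemma dual_le_trans : transitive dual_le.
Proof.
move=> g f h /dual_leP fg /dual_leP gh; apply/dual_leP => v v0.
by rewrite (le_trans (fg v v0)) ?gh.
Qed.

Definition pos_values h v : set R := [set h w | w in [set w | 0 <=v w /\ w <=v v]].

Definition pos_sup h v : R := sup (pos_values h v).

Lemma pos_values_has_sup h v : 0 <=v v -> has_sup (pos_values h v).
Proof.
move=> v0; split; first by exists (h 0), 0 => //=; split => //; exact: lv_lexx.
exists (`|h| * `|v|) => _ [w /= [w0 wv] <-].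
rewrite (le_trans (ler_norm _))// (le_trans (ler_bop_norm _ _))//.
by rewrite ler_wpM2l// ler_norm_pos.
Qed.

Lemma pos_sup_ge h v w : 0 <=v w -> w <=v v -> h w <= pos_sup h v.
Proof.
move=> w0 wv.
apply: (ub_le_sup (pos_values_has_sup h (lv_le_transl w0 wv)).2).
by exists w.
Qed.

Lemma pos_sup_le h v c : 0 <=v v ->
  (forall w, 0 <=v w -> w <=v v -> h w <= c) -> pos_sup h v <= c.
Proof.
move=> v0 hc; apply: ge_sup; first exact: (pos_values_has_sup h v0).1.
by move=> _ [w /= [w0 wv] <-]; exact: hc.
Qed.

Lemma pos_sup_ge0 h v : 0 <=v v -> 0 <= pos_sup h v.
Proof. by move=> v0; rewrite -(linear0 h) pos_sup_ge ?lv_lexx. Qed.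

Lemma pos_supD h x y : 0 <=v x -> 0 <=v y ->
  pos_sup h (x + y) = pos_sup h x + pos_sup h y.
Proof.
move=> x0 y0; have xy0 := lv_addr_ge0 x0 y0.
apply/eqP; rewrite eq_le; apply/andP; split.
  apply: pos_sup_le => // w w0 wxy.
  have [z [z0 zx wz0 wzy]] := riesz_decomposition w0 wxy x0 y0.
  by rewrite -[w](subrK z) linearD/= addrC lerD// pos_sup_ge.
rewrite -lerBrDr; apply: pos_sup_le => // z z0 zx.
rewrite lerBrDr addrC -lerBrDr; apply: pos_sup_le => // w w0 wy.
rewrite lerBrDr -[leLHS]linearD/= pos_sup_ge ?lv_addr_ge0//.
by rewrite addrC lv_leD.
Qed.

Lemma pos_supZ h a x : 0 <= a -> 0 <=v x -> pos_sup h (a *: x) = a * pos_sup h x.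
Proof.
have le b y : 0 < b -> 0 <=v y -> pos_sup h (b *: y) <= b * pos_sup h y.
  move=> b0 y0; have by0 := lv_scaler_ge0 (ltW b0) y0.
  apply: pos_sup_le => // w w0 wy.
  have bV0 : 0 <= b^-1 by rewrite invr_ge0 ltW.
  rewrite -ler_pdivrMl// -[leLHS]/(b^-1 *: (h w : R^o)) -linearZ/=.
  rewrite pos_sup_ge ?lv_scaler_ge0//.
  have -> : y = b^-1 *: (b *: y) by rewrite scalerA mulVf ?gt_eqF// scale1r.
  exact: lv_leZ.
rewrite le_eqVlt => /predU1P[<-|a0] x0.
  rewrite scale0r mul0r; apply/eqP; rewrite eq_le pos_sup_ge0 ?lv_lexx// andbT.
  apply: pos_sup_le => [|w w0 w0']; first exact: lv_lexx.
  have -> : w = 0 by apply/lv_le_anti; rewrite w0 w0'.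
  by rewrite linear0.
apply/eqP; rewrite eq_le le//=.
rewrite -ler_pdivlMl// (le_trans _ (le a^-1 (a *: x) _ _)) ?invr_gt0//.
  by rewrite scalerA mulVf ?gt_eqF// scale1r.
by rewrite lv_scaler_ge0// ltW.
Qed.

Lemma pos_part_bounded h :
  (cone_ext (pos_sup h) : V -> R^o) \in @bounded_operator R V R^o.
Proof.
have psle v : `|pos_sup h (lpos v)| <= `|h| * `|v|.
  rewrite ger0_norm ?pos_sup_ge0 ?lpos_ge0//.
  apply: pos_sup_le => [|w w0 wv]; first exact: lpos_ge0.
  rewrite (le_trans (ler_norm _))// (le_trans (ler_bop_norm _ _))//.
  by rewrite ler_wpM2l// (le_trans (ler_norm_pos w0 wv)) ?ler_norm_lpos.
rewrite inE; split.
  by apply: cone_ext_linear; [exact: pos_supD|exact: pos_supZ].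
exists (`|h| + `|h|) => v; rewrite (le_trans (ler_normB _ _))// mulrDl lerD//.
by rewrite -(normrN v) psle.
Qed.

Definition pos_part h : dual V := Bop (pos_part_bounded h).

Lemma pos_partE h v : 0 <=v v -> pos_part h v = pos_sup h v.
Proof.
by move=> v0; apply: cone_ext_pos => //; [exact: pos_supD|exact: pos_supZ].
Qed.

Lemma pos_part_le h f : dual_le (pos_part h) f = dual_le h f && dual_le 0 f.
Proof.
apply/dual_leP/andP => [hf|[/dual_leP hf /dual_leP f0] v v0].
  split; apply/dual_leP => v v0; rewrite (le_trans _ (hf v v0))// pos_partE//.
    exact/pos_sup_ge/lv_lexx.
  exact: pos_sup_ge0.
rewrite pos_partE//; apply: pos_sup_le => // w w0 wv.
rewrite (le_trans (hf w w0))// -subr_ge0 -[leRHS]linearB/=.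
by apply: f0; rewrite lv_subr_ge0.
Qed.

Lemma dual_leD2r h f g : dual_le f g -> dual_le (f + h) (g + h).
Proof.
move=> /dual_leP fg; apply/dual_leP => v v0.
by change (f v + h v <= g v + h v); rewrite lerD2r fg.
Qed.

Lemma dual_leD2rE h f g : dual_le (f + h) (g + h) = dual_le f g.
Proof.
by apply/idP/idP => [/(dual_leD2r (- h))|]; [rewrite !addrK|exact: dual_leD2r].
Qed.

Lemma dual_leZ (a : R) f g : 0 <= a -> dual_le f g -> dual_le (a *: f) (a *: g).
Proof.
move=> a0 /dual_leP fg; apply/dual_leP => v v0.
by change (a * f v <= a * g v); rewrite ler_wpM2l// fg.
Qed.

Definition dual_join f g : dual V := pos_part (f - g) + g.
Definition dual_meet f g : dual V := f - pos_part (f - g).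

Lemma dual_leUx f g h :
  dual_le (dual_join f g) h = dual_le f h && dual_le g h.
Proof.
rewrite /dual_join -(dual_leD2rE (- g)) addrK pos_part_le dual_leD2rE.
by rewrite -[X in dual_le X (h - g)](subrr g) dual_leD2rE.
Qed.

Lemma dual_lexI h f g :
  dual_le h (dual_meet f g) = dual_le h f && dual_le h g.
Proof.
rewrite /dual_meet -(dual_leD2rE (pos_part (f - g))) subrK.
rewrite -(dual_leD2rE (- h)) addrAC subrr add0r pos_part_le andbC.
congr (_ && _).
  by rewrite -(dual_leD2rE h) subrK add0r.
rewrite -(dual_leD2rE (h + g - f)).
have -> : f - g + (h + g - f) = h.
  by rewrite -[f - g]opprB -[h + g - f]addrA [h + _]addrC addKr.
by rewrite -[f - h]opprB [h + g - f]addrAC addKr.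
Qed.

Lemma dual_le_normr f g :
  dual_le (dual_join f (- f)) (dual_join g (- g)) -> `|f| <= `|g|.
Proof.
have joinl h : dual_le h (dual_join h (- h)).
  by have := dual_le_refl (dual_join h (- h)); rewrite dual_leUx => /andP[].
have joinr h : dual_le (- h) (dual_join h (- h)).
  by have := dual_le_refl (dual_join h (- h)); rewrite dual_leUx => /andP[].
move=> fg; apply: op_norm_le => v v1.
have labsg w : 0 <=v w -> dual_join g (- g) w <= `|g| * `|w|.
  move=> w0; change (pos_part (g - - g) w - g w <= `|g| * `|w|).
  rewrite pos_partE// lerBlDr; apply: pos_sup_le => // z z0 zw.
  change (g z - - g z <= `|g| * `|w| + g w).
  rewrite opprK -lerBlDr -[g z + _]linearD -[leLHS]linearB/=.
  rewrite (le_trans (ler_norm _))// (le_trans (ler_bop_norm _ _))//.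
  rewrite ler_wpM2l// ler_norm_labs// labs_le lv_leBl lv_leD//=.
  by rewrite -[X in X <=v _]add0r lv_leD2rE lv_addr_ge0.
have labsf w : 0 <=v w -> `|f w| <= dual_join f (- f) w.
  move=> w0; rewrite ler_norml lerNl; apply/andP; split.
    by have /dual_leP/(_ _ w0) := joinr f.
  by have /dual_leP/(_ _ w0) := joinl f.
have flabs : `|f v| <= dual_join f (- f) (labs v).
  move: (dual_join f (- f)) labsf => j labsf.
  rewrite labsE -{1}[v]lposB linearB linearD (le_trans (ler_normB _ _))//.
  by rewrite lerD// labsf// lpos_ge0.
rewrite (le_trans flabs)//.
move/dual_leP/(_ _ (labs_ge0 v)) : fg => /le_trans -> //.
by rewrite (le_trans (labsg _ (labs_ge0 v)))// norm_labs ler_piMr.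
Qed.

HB.instance Definition _ :=
  CompleteNormedModule_isBanachLattice.Build R (dual V)
    dual_le_refl dual_le_anti dual_le_trans dual_leUx dual_lexI
    dual_leD2r dual_leZ dual_le_normr.

End DualLattice.

Definition weak_star {R : realType} (V : normedModType R) : Type :=
  initial_topology (fun phi : dual V => (phi : {ptws V -> R})).

HB.instance Definition _ {R : realType} (V : normedModType R) :=
  Topological.on (weak_star V).

Section ConvexAnalysis.
Context {R : realType} {X : normedModType R}.
Local Open Scope ereal_scope.
Implicit Types phi : X -> \bar R.

Definition edom phi : set X := [set x | phi x < +oo].

Definition eproper phi : Prop := edom phi !=set0 /\ forall x, -oo < phi x.

Definition econvex phi : Prop := forall (x y : X) (t : R), (0 <= t <= 1)%R ->
  phi (t *: x + (1 - t) *: y)%R <= t%:E * phi x + (1 - t)%:E * phi y.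

Definition econjugate phi (xi : dual X) : \bar R :=
  ereal_sup [set (xi x)%:E - phi x | x in [set: X]].

End ConvexAnalysis.

Definition weak_star_lsc {R : realType} {V : normedModType R}
    (phi : dual V -> \bar R) : Prop :=
  lower_semicontinuous (phi : weak_star V -> \bar R).

Section Operators.
Context {R : realType}.
Implicit Types X Y Z : normedModType R.

Lemma bop_id_subproof X : (id : X -> X) \in @bounded_operator R X X.
Proof. by rewrite inE; split=> //; exists 1 => x; rewrite mul1r. Qed.

Definition bop_id X : bop X X := Bop (bop_id_subproof X).

Lemma bop_comp_subproof X Y Z (g : bop Y Z) (f : bop X Y) :
  (g \o f : X -> Z) \in @bounded_operator R X Z.
Proof.
rewrite inE; split=> [a x y|]; first by rewrite /= !linearP.
exists (`|g| * `|f|) => x; rewrite (le_trans (ler_bop_norm _ _))// -mulrA.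
by rewrite ler_wpM2l// ler_bop_norm.
Qed.

Definition bop_comp X Y Z (g : bop Y Z) (f : bop X Y) : bop X Z :=
  Bop (bop_comp_subproof g f).

Lemma bop_pair_subproof X Y Z (f : bop X Y) (g : bop X Z) :
  (fun x => (f x, g x) : Y * Z) \in @bounded_operator R X (Y * Z)%type.
Proof.
rewrite inE; split=> [a x y|]; first by rewrite !linearP.
exists (`|f| + `|g|) => x; rewrite prod_normE/= ge_max mulrDl.
rewrite (le_trans (ler_bop_norm _ _)) ?lerDl ?mulr_ge0//=.
by rewrite (le_trans (ler_bop_norm _ _)) ?lerDr ?mulr_ge0.
Qed.

Definition bop_pair X Y Z (f : bop X Y) (g : bop X Z) : bop X (Y * Z)%type :=
  Bop (bop_pair_subproof f g).

Definition adjoint X Y (T : bop X Y) (mu : dual Y) : dual X := bop_comp mu T.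

Lemma prod_dual_subproof Y Z (mu : dual Y * dual Z) :
  (fun y : Y * Z => mu.1 y.1 + mu.2 y.2 : R^o)
    \in @bounded_operator R (Y * Z)%type R^o.
Proof.
rewrite inE; split=> [a x y|].
  by rewrite !linearP /= scalerDr addrACA.
exists (`|mu.1| + `|mu.2|) => y; rewrite (le_trans (ler_normD _ _))// mulrDl.
by rewrite lerD// (le_trans (ler_bop_norm _ _))// ler_wpM2l// prod_normE/=
  le_max lexx ?orbT.
Qed.

(* The identification of Y^* x Z^* with (Y x Z)^*. *)
Definition prod_dual Y Z (mu : dual Y * dual Z) : dual (Y * Z)%type :=
  Bop (prod_dual_subproof mu).

End Operators.

Section AMSpace.
Context {R : realType} (Y : banachLatticeType R).

Definition AM_space : Prop := forall x y : Y, 0 <=v x -> 0 <=v y ->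
  `|lv_join x y| = Num.max `|x| `|y|.

Definition lattice_unit (e : Y) : Prop :=
  [/\ 0 <=v e, `|e| = 1 & forall x : Y, `|x| <= 1 -> labs x <=v e].

End AMSpace.

Definition prod_le {R : realType} {Y Z : banachLatticeType R} (p q : Y * Z) :
  bool := (p.1 <=v q.1) && (p.2 <=v q.2).

Section Problem.
Context {R : realType} {U V : banachLatticeType R}.
Local Notation X := (dual U).
Local Notation Y := (dual V).
Variables (Al Au : bop X Y) (f : Y) (alpha : R).
Variables (J : X -> \bar R) (H : Y -> Y -> \bar R).
Implicit Types (u : X) (v : Y) (mu : dual Y * dual Y).

Definition opB : bop X (Y * Y)%type := bop_pair Al (- Au).
Definition opE : bop Y (Y * Y)%type := bop_pair (bop_id Y) (- bop_id Y).

Definition primal_objective u v : \bar R := ((alpha^-1)%:E * H v f + J u)%E.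

Definition primal_solution u v : Prop := prod_le (opB u) (opE v) /\
  forall u' v', prod_le (opB u') (opE v') ->
    (primal_objective u v <= primal_objective u' v')%E.

(* A proper function has a conjugate > -oo everywhere, so the conventions of
   \bar R for +oo - +oo play no role here. *)
Definition dual_objective mu : \bar R :=
  (- ((alpha^-1)%:E * econjugate (H ^~ f) (alpha *: adjoint opE (prod_dual mu))%R)
   - econjugate J (- adjoint opB (prod_dual mu))%R)%E.

Definition dual_solution mu : Prop := prod_le 0 mu /\
  forall mu', prod_le 0 mu' -> (dual_objective mu' <= dual_objective mu)%E.

Definition lagrangian mu u v : \bar R :=
  ((alpha^-1)%:E * H v f + J u + (prod_dual mu (opB u - opE v)%R)%:E)%E.

Definition lagrange_multiplier mu u v : Prop :=
  [/\ prod_le 0 mu,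
      forall u' v', (lagrangian mu u v <= lagrangian mu u' v')%E &
      prod_dual mu (opB u - opE v) = 0].

End Problem.

(* Main.v *)
Require Import Defs.
From mathcomp Require Import all_boot all_order all_algebra.
From mathcomp Require Import all_classical all_reals all_analysis.
From mathcomp Require Import lra.

Set Implicit Arguments.
Unset Strict Implicit.
Unset Printing Implicit Defensive.

Import Order.TTheory GRing.Theory Num.Theory.
Import numFieldNormedType.Exports.
Local Open Scope classical_set_scope.
Local Open Scope ring_scope.

(** Write w = (u, v), Phi w = H(v|f)/alpha + J(u) and G w = Bu - Ev.  The proof
is Lagrange duality under Slater's condition.

Since a unit dominates the unit ball, the hypothesis on (u0, v0) says that
G(u0, v0) lies in the interior of the negative cone: G(u0, v0) <= z as soon as
`|z| <= eps (lemma slater_gap).  Hence, if m is the infimum of Phi over the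
feasible points, the function

  p(z) = inf { s (Phi w - m) | s > 0, Phi w < +oo, s G w <= z }

is finite and sublinear: the Slater point makes the set nonempty, and mixing any
of its elements with the Slater point produces a feasible point, which bounds
the set from below.  A linear functional l <= p (Hahn-Banach, in the form
hahn_banach_sublinear) is bounded because p(z) <= (Phi(u0, v0) - m) |z| / eps,
is nonpositive on the positive cone because p is, and with s = 1 and z = G w it
gives m <= Phi w - l (G w).  So mu = - l is a nonnegative bounded functional
with m <= Phi w + <mu, G w> for every w (theorem slater_multiplier).

The dual objective at mu is the infimum over w of the Lagrangian
Phi w + <mu, G w> (lemmas dual_objective_le and dual_objective_ge): the
variables u and v separate, and each partial infimum is, up to scaling, minus a
conjugate.  Consequently no mu' >= 0 has a dual value above m, whereas the
multiplier just found has dual value m.  If w is a primal solution, then Phi w = m together with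
m <= Phi w + <mu, G w> <= Phi w forces <mu, G w> = 0, and w minimises the
Lagrangian. *)

(** * Hahn-Banach for sublinear functionals *)

Section Sublinear.
Context {R : realType} {E : lmodType R}.
Implicit Types (q p : E -> R) (x y : E).

Definition sublinear q : Prop :=
  (forall x y, q (x + y) <= q x + q y) /\
  (forall (a : R) x, 0 < a -> q (a *: x) <= a * q x).

Lemma sublinear0 q : sublinear q -> q 0 = 0.
Proof.
move=> [_ qZ]; have h2 : (0 : R) < 2^-1 by rewrite invr_gt0.
have := qZ 2 0 (ltr0Sn R 1); have := qZ 2^-1 0 h2; rewrite !scaler0; lra.
Qed.

Lemma sublinearZ q (a : R) x : sublinear q -> 0 <= a -> q (a *: x) = a * q x.
Proof.
move=> qs; rewrite le_eqVlt => /predU1P[<-|a0].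
  by rewrite scale0r mul0r sublinear0.
have [_ qZ] := qs; apply/eqP; rewrite eq_le qZ//= -ler_pdivlMl//.
have := qZ a^-1 (a *: x); rewrite invr_gt0 scalerA mulVf ?gt_eqF// scale1r.
exact.
Qed.

Lemma sublinearN q x : sublinear q -> - q (- x) <= q x.
Proof.
by move=> qs; have := qs.1 x (- x); rewrite subrr sublinear0// -lerBlDr sub0r.
Qed.

(** The three infima below (over a chain, over the translates of a functional
along a line, over the points of a convex program) are all sublinear for this
reason. *)
Lemma inf_sublinear (S : E -> set R) :
  (forall x, S x !=set0) -> (forall x, has_lbound (S x)) ->
  (forall x y a b, S x a -> S y b -> exists2 c, S (x + y) c & c <= a + b) ->
  (forall (t : R) x a, 0 < t -> S x a -> exists2 c, S (t *: x) c & c <= t * a) ->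
  sublinear (fun x => inf (S x)).
Proof.
move=> S0 Slb SD SZ; split=> [x y|t x t0].
  rewrite -lerBlDr; apply: lb_le_inf => // a Sa.
  rewrite lerBlDr [a + _]addrC -lerBlDr; apply: lb_le_inf => // b Sb.
  have [c Sc cab] := SD _ _ _ _ Sa Sb.
  by rewrite lerBlDr [b + a]addrC (le_trans _ cab)// ge_inf.
rewrite -ler_pdivrMl//; apply: lb_le_inf => // a Sa; rewrite ler_pdivrMl//.
by have [c Sc cta] := SZ _ _ _ t0 Sa; rewrite (le_trans _ cta)// ge_inf.
Qed.

(** Flattening q along x, by z |-> inf over t >= 0 of q (z + t x) - t q x, gives
a sublinear functional below q.  By minimality it is q itself, and then the
choice t = 1 bounds q y by q (y + x) - q x. *)
Lemma minimal_sublinear_superadditive q : sublinear q ->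
  (forall q', sublinear q' -> (forall x, q' x <= q x) -> q' = q) ->
  forall x y, q x + q y <= q (x + y).
Proof.
move=> qs qmin x y.
pose S z := [set q (z + t *: x) - t * q x | t in [set t | 0 <= t]].
have Slb z : has_lbound (S z).
  exists (- q (- z)) => _ [t /= t0 <-].
  have := qs.1 (z + t *: x) (- z).
  by rewrite addrAC subrr add0r sublinearZ//; lra.
have Ss : sublinear (fun z => inf (S z)).
  apply: inf_sublinear => // [z|z w _ _ [s /= s0 <-] [t /= t0 <-]|].
  - by exists (q (z + 0 *: x) - 0 * q x), 0 => /=.
  - exists (q (z + w + (s + t) *: x) - (s + t) * q x).
      by exists (s + t) => //=; rewrite addr_ge0.
    have := qs.1 (z + s *: x) (w + t *: x).
    by rewrite addrACA -scalerDl mulrDl; lra.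
  - move=> t z _ t0 [s /= s0 <-].
    exists (q (t *: z + (t * s) *: x) - (t * s) * q x).
      by exists (t * s) => //=; rewrite mulr_ge0// ltW.
    by rewrite -scalerA -scalerDr mulrBr mulrA lerB// qs.2.
have SE : (fun z => inf (S z)) = q.
  apply: qmin => // z; apply: ge_inf => //.
  by exists 0 => //=; rewrite scale0r addr0 mul0r subr0.
have SEy : inf (S y) = q y := congr1 (@^~ y) SE.
rewrite -SEy -lerBrDl; apply: ge_inf => //.
by exists 1 => //=; rewrite scale1r mul1r [y + x]addrC.
Qed.

(** Zorn's lemma: a chain of sublinear functionals below p has the pointwise
infimum as a lower bound, which is finite because every such q satisfies
- p (- x) <= q x. *)
Lemma minimal_sublinear_ex p : sublinear p -> exists q,
  [/\ sublinear q, forall x, q x <= p x &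
      forall q', sublinear q' -> (forall x, q' x <= q x) -> q' = q].
Proof.
move=> ps; pose T := {q : E -> R | sublinear q /\ forall x, q x <= p x}.
pose ge (q r : T) := `[< forall x, sval r x <= sval q x >].
have [|r q s /asboolP rq /asboolP qs||A totA|q qmin] := @Zorn T ge.
- by move=> q; apply/asboolP.
- by apply/asboolP => x; exact: le_trans (qs x) (rq x).
- move=> [q qP] [r rP] /asboolP/= qr /asboolP/= rq; apply/eq_exist/funext => x.
  by apply/le_anti; rewrite qr rq.
- have [A0|/set0P A0] := eqVneq A set0.
    by exists (exist _ p (conj ps (fun=> lexx _))) => s; rewrite A0.
  pose S x := [set sval q x | q in A].
  have Slb x : has_lbound (S x).
    exists (- p (- x)) => _ [[q [qs qp]] /= _ <-].
    by rewrite (le_trans _ (sublinearN x qs))// lerN2.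
  have Ss : sublinear (fun x => inf (S x)).
    apply: inf_sublinear => // [x|x y _ _ [q Aq <-] [r Ar <-]|t x _ t0 [q Aq <-]].
    + by have [q Aq] := A0; exists (sval q x), q.
    + have [/asboolP qr|/asboolP rq] := totA _ _ Aq Ar.
        exists (sval r (x + y)); first by exists r.
        by rewrite (le_trans ((svalP r).1.1 _ _))// lerD2r.
      exists (sval q (x + y)); first by exists q.
      by rewrite (le_trans ((svalP q).1.1 _ _))// lerD2l.
    + exists (sval q (t *: x)); first by exists q.
      by rewrite (svalP q).1.2.
  have Sp x : inf (S x) <= p x.
    have [q Aq] := A0; apply: (le_trans _ ((svalP q).2 x)).
    by apply: ge_inf => //; exists q.
  pose s : T := exist _ (fun x => inf (S x)) (conj Ss Sp).
  exists s => q Aq; apply/asboolP => x /=.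
  by apply: ge_inf => //; exists q.
exists (sval q); have [qs qp] := svalP q; split=> // r rs rq.
have rp x : r x <= p x := le_trans (rq x) (qp x).
by rewrite -(qmin (exist _ r (conj rs rp)))//; apply/asboolP.
Qed.

(** Working with minimal sublinear functionals avoids extending partial linear
maps one dimension at a time: a minimal one is additive, hence linear. *)
Lemma hahn_banach_sublinear p : sublinear p ->
  exists l : E -> R^o, linear l /\ forall x, l x <= p x.
Proof.
move=> /minimal_sublinear_ex[q [qs qp qmin]]; exists q; split=> //.
have qD x y : q (x + y) = q x + q y.
  apply/le_anti; rewrite qs.1/=; exact: minimal_sublinear_superadditive.
have qN x : q (- x) = - q x.
  by apply/eqP; rewrite -addr_eq0 -qD addNr sublinear0.
move=> a x y; rewrite qD; congr (_ + _).
have [a0|a0] := leP 0 a; first by rewrite sublinearZ.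
rewrite -[a]opprK scaleNr qN sublinearZ ?oppr_ge0 1?ltW//.
by rewrite scaleNr.
Qed.

End Sublinear.

(** * Multipliers of convex programs *)

Section LagrangeMultiplier.
Context {R : realType} {W : lmodType R} {Z : normedModType R}.
Variables (K : set Z) (D : set W) (F : W -> R) (G : W -> Z) (w0 : W) (e m : R).
Hypothesis KD : forall x y, K x -> K y -> K (x + y).
Hypothesis KZ : forall (a : R) x, 0 <= a -> K x -> K (a *: x).
Hypothesis D_convex : forall x y (t : R), D x -> D y -> 0 <= t <= 1 ->
  D (t *: x + (1 - t) *: y).
Hypothesis F_convex : forall x y (t : R), D x -> D y -> 0 <= t <= 1 ->
  F (t *: x + (1 - t) *: y) <= t * F x + (1 - t) * F y.
Hypothesis G_convex : forall x y (t : R), D x -> D y -> 0 <= t <= 1 ->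
  K (t *: G x + (1 - t) *: G y - G (t *: x + (1 - t) *: y)).
Hypothesis Dw0 : D w0.
Hypothesis e0 : 0 < e.
Hypothesis slater : forall z, `|z| <= e -> K (z - G w0).
Hypothesis m_le : forall w, D w -> K (- G w) -> m <= F w.

Definition perspective_values (z : Z) : set R :=
  [set r | exists (s : R) w, [/\ 0 < s, D w, K (z - s *: G w) & r = s * (F w - m)]].

(** Homogeneous form of convexity: the perspective s (F (x / s) - m) is jointly
subadditive in s and x. *)
Lemma convex_mix (s t : R) x y : 0 < s -> 0 < t -> D x -> D y ->
  exists w, [/\ D w, K (s *: G x + t *: G y - (s + t) *: G w) &
    (s + t) * (F w - m) <= s * (F x - m) + t * (F y - m)].
Proof.
move=> s0 t0 Dx Dy; have st0 : 0 < s + t by rewrite addr_gt0.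
have stn0 : s + t != 0 by rewrite gt_eqF.
have [a [a01 sE tE]] : exists a : R,
    [/\ 0 <= a <= 1, (s + t) * a = s & (s + t) * (1 - a) = t].
  exists (s / (s + t)); have sE : (s + t) * (s / (s + t)) = s by rewrite mulrC divfK.
  split=> //; last by rewrite mulrBr sE mulr1 addrAC subrr add0r.
  by rewrite divr_ge0 ?(ltW s0) ?(ltW st0)//= ler_pdivrMr// mul1r lerDl ltW.
exists (a *: x + (1 - a) *: y); split; first exact: D_convex.
  have := KZ (ltW st0) (G_convex Dx Dy a01).
  by rewrite scalerBr scalerDr !scalerA sE tE.
have := F_convex Dx Dy a01; rewrite -(ler_pM2l st0).
by rewrite mulrDr !mulrA sE tE; lra.
Qed.

Lemma slater_scaled (s : R) z : 0 < s -> `|z| <= s * e -> K (z - s *: G w0).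
Proof.
move=> s0 zs; have -> : z = s *: (s^-1 *: z).
  by rewrite scalerA mulfV ?gt_eqF// scale1r.
rewrite -scalerBr; apply: KZ; [exact: ltW|apply: slater].
by rewrite normrZ gtr0_norm ?invr_gt0// ler_pdivrMl.
Qed.

Lemma le_slater_value : m <= F w0.
Proof. by apply: m_le => //; rewrite -sub0r; apply: slater; rewrite normr0 ltW. Qed.

Lemma perspective_values_slater (s : R) z : 0 < s -> `|z| <= s * e ->
  perspective_values z (s * (F w0 - m)).
Proof. by move=> s0 zs; exists s, w0; split=> //; exact: slater_scaled. Qed.

Lemma perspective_valuesD x y a b :
  perspective_values x a -> perspective_values y b ->
  exists2 c, perspective_values (x + y) c & c <= a + b.
Proof.
move=> [s [w [s0 Dw Kw ->]]] [t [w' [t0 Dw' Kw' ->]]].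
have [v [Dv Kv Fv]] := convex_mix s0 t0 Dw Dw'.
exists ((s + t) * (F v - m)) => //; exists (s + t), v; split=> //.
  by rewrite addr_gt0.
have := KD (KD Kw Kw') Kv.
by rewrite [x - _ + _]addrACA -opprD addrA subrK.
Qed.

(** A value at z and a Slater value at - z add up to a value at 0, which comes
from a feasible point and is therefore nonnegative. *)
Lemma perspective_values_lbound z : has_lbound (perspective_values z).
Proof.
pose s := `|z| / e + 1.
have s0 : 0 < s by rewrite ltr_wpDl// divr_ge0// ltW.
have zs : `|- z| <= s * e by rewrite normrN mulrDl divfK ?gt_eqF// mul1r lerDl ltW.
exists (- (s * (F w0 - m))) => r rz; rewrite -subr_ge0 opprK.
have [c + cle] := perspective_valuesD rz (perspective_values_slater s0 zs).
rewrite subrr => -[t [w [t0 Dw Kw cE]]].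
apply: le_trans cle; rewrite cE mulr_ge0 ?(ltW t0)// subr_ge0; apply: m_le => //.
have -> : - G w = t^-1 *: (0 - t *: G w).
  by rewrite sub0r scalerN scalerA mulVf ?gt_eqF// scale1r.
by apply: KZ => //; rewrite invr_ge0 ltW.
Qed.

Lemma perspective_sublinear : sublinear (fun z => inf (perspective_values z)).
Proof.
apply: inf_sublinear => [z|||a z _ a0 [s [w [s0 Dw Kw ->]]]].
- pose s := `|z| / e + 1.
  have s0 : 0 < s by rewrite ltr_wpDl// divr_ge0// ltW.
  exists (s * (F w0 - m)); apply: perspective_values_slater => //.
  by rewrite mulrDl divfK ?gt_eqF// mul1r lerDl ltW.
- exact: perspective_values_lbound.
- exact: perspective_valuesD.
- exists (a * s * (F w - m)); last by rewrite mulrA.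
  exists (a * s), w; split=> //; first by rewrite mulr_gt0.
  by rewrite -scalerA -scalerBr; apply: KZ => //; exact: ltW.
Qed.

(** The multiplier is minus a linear functional below the infimum of the
perspective values; its continuity comes from their bound at the Slater point,
which is linear in the norm. *)
Theorem slater_multiplier : exists mu : dual Z,
  (forall z, K z -> 0 <= mu z) /\ forall w, D w -> m <= F w + mu (G w).
Proof.
have [l [l_lin l_inf]] := hahn_banach_sublinear perspective_sublinear.
have l_le z r : perspective_values z r -> l z <= r.
  by move=> zr; rewrite (le_trans (l_inf z))// ge_inf//; exact: perspective_values_lbound.
have lN z : l (- z) = - l z.
  have l0 : l 0 = 0 by have := l_lin (-1) 0 0; rewrite scaler0 addr0 scaleN1r addNr.
  by have := l_lin (-1) z 0; rewrite addr0 l0 addr0 !scaleN1r.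
pose c := F w0 - m; have c0 : 0 <= c by rewrite subr_ge0 le_slater_value.
have l_bound z : l z <= c / e * `|z|.
  have [->|z0] := eqVneq z 0.
    by have := lN 0; rewrite oppr0 normr0 mulr0; lra.
  have s0 : 0 < `|z| / e by rewrite divr_gt0 ?normr_gt0.
  rewrite mulrAC -mulrA mulrC; apply/l_le/perspective_values_slater => //.
  by rewrite divfK ?gt_eqF.
have mu_op : (fun z => - l z : R^o) \in @bounded_operator R Z R^o.
  rewrite inE; split=> [a x y|]; first by rewrite l_lin opprD scalerN.
  exists (c / e) => z; rewrite normrN ler_norml l_bound andbT.
  by rewrite lerNl -lN -(normrN z) l_bound.
exists (Bop mu_op); split=> [z Kz|w Dw] /=.
- rewrite oppr_ge0 leNgt; apply/negP => lz0.
  (* Every s > 0 gives l z <= s * c by scaling the Slater point; this s makes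
     s * c smaller than l z, also when c = 0. *)
  have c10 : 0 < c + 1 by rewrite ltr_wpDl.
  pose s := l z / (c + 1); have s0 : 0 < s by rewrite divr_gt0.
  have : l z <= s * c.
    apply: l_le; exists s, w0; split=> //; apply: KD => //; rewrite -scalerN.
    by apply: KZ; [exact: ltW|rewrite -sub0r; apply: slater; rewrite normr0 ltW].
  have : s * c + s = l z by rewrite -[X in _ + X]mulr1 -mulrDr divfK ?gt_eqF.
  by move: s0; lra.
- have : l (G w) <= 1 * (F w - m).
    apply: l_le; exists 1, w; split=> //; rewrite scale1r subrr.
    by rewrite -(scale0r (0 - G w0)); apply: KZ => //; apply: slater; rewrite normr0 ltW.
  lra.
Qed.

End LagrangeMultiplier.

(** * Conjugates of separable functions *)

Section Conjugate.
Context {R : realType}.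

Lemma proper_fin_num (X : normedModType R) (phi : X -> \bar R) x :
  eproper phi -> edom phi x -> phi x \is a fin_num.
Proof. by move=> [_ phiNy] phix; rewrite fin_real// phiNy. Qed.

Lemma fenchel_young (X : normedModType R) (phi : X -> \bar R) (xi : dual X) x :
  ((xi x)%:E - phi x <= econjugate phi xi)%E.
Proof. by apply: ereal_sup_ubound; exists x. Qed.

Lemma econjugate_gtNy (X : normedModType R) (phi : X -> \bar R) (xi : dual X) :
  eproper phi -> (-oo < econjugate phi xi)%E.
Proof.
move=> phip; have [[x phix] _] := phip.
apply: lt_le_trans (fenchel_young phi xi x).
by rewrite -(fineK (proper_fin_num phip phix)) -EFinB ltNyr.
Qed.

Lemma econjugate_le (X : normedModType R) (phi : X -> \bar R) (xi : dual X) (c : R) :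
  eproper phi -> (forall x, edom phi x -> xi x - fine (phi x) <= c) ->
  (econjugate phi xi <= c%:E)%E.
Proof.
move=> phip phic; apply/ereal_supP => _ [x _ <-].
have [phix|] := boolP (phi x < +oo)%E.
  by rewrite -(fineK (proper_fin_num phip phix)) -EFinB lee_fin; exact: phic.
by rewrite -leNgt leye_eq => /eqP ->; rewrite addeC leNye.
Qed.

(** The next two lemmas say that minimising a separable function minus a linear
form splits into two conjugates.  The upper bound is Fenchel-Young twice; for
the lower bound one supremum is taken at a time, the first conjugate being shown
finite before the second is bounded. *)
Section Separable.
Variables (X Y : normedModType R) (phi : X -> \bar R) (psi : Y -> \bar R).
Variables (b : R) (xi : dual X) (eta : dual Y).
Hypotheses (b0 : 0 < b) (phip : eproper phi) (psip : eproper psi).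

Lemma separable_conjugate_le x y :
  (- (b%:E * econjugate psi eta) - econjugate phi xi
   <= b%:E * psi y + phi x - (xi x + b * eta y)%:E)%E.
Proof.
have [phix|] := boolP (phi x < +oo)%E; last first.
  rewrite -leNgt leye_eq => /eqP ->; rewrite addey ?addye ?leey//.
  rewrite -ltNye; apply: (@lt_le_trans _ _ (b%:E * psi y)%E) => //.
  by have := psip.2 y; case: (psi y) => [r||]//= _; rewrite ?gt0_muley ?lte_fin// -EFinM ltNyr.
have [psiy|] := boolP (psi y < +oo)%E; last first.
  rewrite -leNgt leye_eq => /eqP ->; rewrite gt0_muley ?lte_fin//.
  by rewrite -(fineK (proper_fin_num phip phix)) leey.
have := fenchel_young psi eta y; have := fenchel_young phi xi x.
have := econjugate_gtNy xi phip; have := econjugate_gtNy eta psip.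
rewrite -(fineK (proper_fin_num phip phix)) -(fineK (proper_fin_num psip psiy)).
case: (econjugate psi eta) => [r| |]//; case: (econjugate phi xi) => [s| |]// _ _;
  rewrite ?gt0_muley ?lte_fin//= ?addNye ?addeNy ?leNye//.
rewrite -!EFinM -!EFinD !lee_fin => le1 le2.
by have := ler_wpM2l (ltW b0) le2; lra.
Qed.

Lemma separable_conjugate_ge (c : R) :
  (forall x y, edom phi x -> edom psi y ->
    c <= b * fine (psi y) + fine (phi x) - (xi x + b * eta y)) ->
  (c%:E <= - (b%:E * econjugate psi eta) - econjugate phi xi)%E.
Proof.
move=> cle; have [[y0 psiy0] _] := psip.
have := econjugate_gtNy xi phip; have := econjugate_gtNy eta psip.
have phi_le y : edom psi y ->
    (econjugate phi xi <= (b * fine (psi y) - b * eta y - c)%:E)%E.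
  move=> psiy; apply: econjugate_le => // x phix.
  by have := cle x y phix psiy; lra.
move: (phi_le y0 psiy0).
case: (econjugate phi xi) phi_le => [s| |]// phi_le _.
have : (econjugate psi eta <= (b^-1 * (- c - s))%:E)%E.
  apply: econjugate_le => // y psiy; rewrite ler_pdivlMl//.
  by have := phi_le y psiy; rewrite lee_fin; lra.
case: (econjugate psi eta) => [r| |]//; rewrite lee_fin ler_pdivlMl// => rle _ _.
by rewrite -EFinM -!EFinN -EFinD lee_fin; lra.
Qed.

End Separable.

Lemma prod_dual_surj (Y Z : normedModType R) (nu : dual (Y * Z)%type) :
  exists mu, forall z, prod_dual mu z = nu z.
Proof.
pose inl : bop Y (Y * Z)%type := bop_pair (bop_id Y) 0.
pose inr : bop Z (Y * Z)%type := bop_pair 0 (bop_id Z).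
exists (bop_comp nu inl, bop_comp nu inr) => z.
change (nu (z.1, 0) + nu (0, z.2) = nu z).
rewrite -[LHS](linearD nu); congr (nu _).
by case: z => y z; congr pair; rewrite /= ?addr0 ?add0r.
Qed.

End Conjugate.

(** * Positive functionals and units *)

Section PositiveFunctionals.
Context {R : realType} {V : banachLatticeType R}.

Lemma dual_ge0P (mu : dual V) : reflect (forall v, 0 <=v v -> 0 <= mu v) (0 <=v mu).
Proof. exact: (dual_leP 0 mu). Qed.

Lemma prod_dual_ge0P (mu : dual V * dual V) :
  reflect (forall z, prod_le 0 z -> 0 <= prod_dual mu z) (prod_le 0 mu).
Proof.
apply: (iffP andP) => [[/dual_ge0P mu1 /dual_ge0P mu2] z /andP[z1 z2]|mu0].
  by rewrite addr_ge0 ?mu1 ?mu2.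
split; apply/dual_ge0P => v v0.
  have := mu0 (v, 0); rewrite /prod_le /= v0 lv_lexx linear0 addr0; exact.
have := mu0 (0, v); rewrite /prod_le /= v0 lv_lexx linear0 add0r; exact.
Qed.

Lemma prod_subr_ge0 (p q : V * V) : prod_le 0 (q - p) = prod_le p q.
Proof. by rewrite /prod_le /= !lv_subr_ge0. Qed.

Lemma prod_ge0D (p q : V * V) : prod_le 0 p -> prod_le 0 q -> prod_le 0 (p + q).
Proof. by move=> /andP[? ?] /andP[? ?]; rewrite /prod_le /= !lv_addr_ge0. Qed.

Lemma prod_ge0Z (a : R) (p : V * V) : 0 <= a -> prod_le 0 p -> prod_le 0 (a *: p).
Proof. by move=> a0 /andP[? ?]; rewrite /prod_le /= !lv_scaler_ge0. Qed.

(** The unit enters here: it turns a norm bound into an order bound. *)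
Lemma unit_ball_le (one x : V) (e : R) :
  lattice_unit one -> 0 < e -> `|x| <= e -> - x <=v e *: one.
Proof.
move=> [_ _ one_ge] e0 xe.
have : labs (e^-1 *: (- x)) <=v one.
  by apply: one_ge; rewrite normrZ normrN gtr0_norm ?invr_gt0// ler_pdivrMl// mulr1.
rewrite labs_le => /andP[/(lv_leZ (ltW e0)) + _].
by rewrite scalerA mulfV ?gt_eqF// scale1r.
Qed.

End PositiveFunctionals.

(** * Duality for the constrained problem *)

Section Duality.
Context {R : realType} {U V : banachLatticeType R}.
Variables (Al Au : bop (dual U) (dual V)) (f : dual V) (alpha : R).
Variables (J : dual U -> \bar R) (H : dual V -> dual V -> \bar R).
Hypotheses (alpha0 : 0 < alpha).
Hypotheses (J0 : forall u, (0 <= J u)%E) (Jp : eproper J) (Jc : econvex J).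
Hypotheses (H0 : forall v, (0 <= H v f)%E) (Hp : eproper (H ^~ f))
  (Hc : econvex (H ^~ f)).

Let B := opB Al Au.
Let E := @opE R V.
Let obj (w : dual U * dual V) := primal_objective f alpha J H w.1 w.2.
Let gap (w : dual U * dual V) := B w.1 - E w.2.
Let D : set (dual U * dual V) := [set w | obj w < +oo]%E.

Let alphaV0 : 0 < alpha^-1. Proof. by rewrite invr_gt0. Qed.

Lemma objective_ge0 w : (0 <= obj w)%E.
Proof. by rewrite adde_ge0// mule_ge0// lee_fin ltW. Qed.

Lemma objective_fineK w : D w -> ((fine (obj w))%:E = obj w)%E.
Proof.
move=> Dw; apply: fineK; rewrite fin_real//.
by rewrite (lt_le_trans _ (objective_ge0 w)) ?ltNyr.
Qed.

Lemma domainE u v : edom J u -> edom (H ^~ f) v -> D (u, v).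
Proof.
move=> Ju Hv; rewrite /D /obj /primal_objective /=.
rewrite -(fineK (proper_fin_num Jp Ju)) -(fineK (proper_fin_num Hp Hv)).
by rewrite -EFinM -EFinD ltry.
Qed.

Lemma objective_convex w w' (t : R) : D w -> D w' -> 0 <= t <= 1 ->
  (obj (t *: w + (1 - t) *: w')%R <=
   (t * fine (obj w) + (1 - t) * fine (obj w'))%:E)%E.
Proof.
move=> Dw Dw' t01; have /andP[t0 t1] := t01.
have t10 : 0 <= 1 - t by rewrite subr_ge0.
rewrite EFinD !EFinM !objective_fineK// /obj /primal_objective.
have aJ w0 : (0 <= (alpha^-1)%:E * H w0 f)%E by rewrite mule_ge0// lee_fin ltW.
rewrite !ge0_muleDr//; rewrite addeACA; apply: leeD; last exact: Jc.
rewrite !muleA [(t%:E * _)%E]muleC [((1 - t)%:E * _)%E]muleC -!muleA.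
rewrite -ge0_muleDr ?mule_ge0 ?lee_fin//.
by apply: lee_wpmul2l; [rewrite lee_fin ltW|exact: Hc].
Qed.

Lemma lagrangianE mu u v : (lagrangian Al Au f alpha J H mu u v =
  (alpha^-1)%:E * H v f + J u
    - ((- adjoint B (prod_dual mu)) u
       + alpha^-1 * (alpha *: adjoint E (prod_dual mu)) v)%:E)%E.
Proof.
rewrite /lagrangian; congr (_ + _)%E; rewrite linearB.
change ((prod_dual mu (B u) - prod_dual mu (E v))%:E =
  - (- prod_dual mu (B u) + alpha^-1 * (alpha * prod_dual mu (E v)))%:E)%E.
by rewrite mulrA mulVf ?gt_eqF// mul1r -EFinN [- (- _ + _)]opprD opprK.
Qed.

(** With dual_objective_ge, the dual objective is the infimum of the
Lagrangian. *)
Lemma dual_objective_le mu u v :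
  (dual_objective Al Au f alpha J H mu <= lagrangian Al Au f alpha J H mu u v)%E.
Proof. by rewrite lagrangianE; exact: separable_conjugate_le. Qed.

Lemma dual_objective_ge mu (c : R) :
  (forall w, D w -> c <= fine (obj w) + prod_dual mu (gap w)) ->
  (c%:E <= dual_objective Al Au f alpha J H mu)%E.
Proof.
move=> cle; apply: separable_conjugate_ge => // u v Ju Hv.
have Dw := domainE Ju Hv.
have := cle (u, v) Dw; rewrite -lee_fin EFinD objective_fineK//.
rewrite -[X in (_ <= X)%E]/(lagrangian Al Au f alpha J H mu u v) lagrangianE.
rewrite -{1}(fineK (proper_fin_num Jp Ju)) -{1}(fineK (proper_fin_num Hp Hv)).
by rewrite -EFinM -EFinD lee_fin.
Qed.

Lemma gap_linear w w' (s t : R) :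
  gap (s *: w + t *: w') = s *: gap w + t *: gap w'.
Proof.
change (B (s *: w.1 + t *: w'.1) - E (s *: w.2 + t *: w'.2) =
  s *: (B w.1 - E w.2) + t *: (B w'.1 - E w'.2)).
rewrite (linearD B) (linearD E) !(linearZ_LR B) !(linearZ_LR E).
by rewrite !scalerBr [- (_ + _)]opprD addrACA.
Qed.

(** Slater's condition: the whole ball of radius eps dominates the constraint
value at (u0, v0). *)
Lemma slater_gap (one : dual V) u0 v0 (eps : R) z : lattice_unit one -> 0 < eps ->
  Al u0 + eps *: one <=v v0 -> v0 <=v Au u0 - eps *: one ->
  `|z| <= eps -> prod_le 0 (z - gap (u0, v0)).
Proof.
move=> one1 eps0 lo up; rewrite prod_normE/= ge_max => /andP[z1 z2].
have {}z1 := unit_ball_le one1 eps0 z1; have {}z2 := unit_ball_le one1 eps0 z2.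
apply/andP; split.
  change (0 <=v z.1 - (Al u0 - v0)).
  have := lv_le_transl (lv_leD (lv_lexx (Al u0)) z1) lo.
  by rewrite lv_subr_ge0 !lv_leBl [v0 + _]addrC.
change (0 <=v z.2 - (- Au u0 - - v0)).
rewrite lv_leBr in up; have := lv_le_transl (lv_leD (lv_lexx v0) z2) up.
by rewrite lv_subr_ge0 opprK [_ + v0]addrC !lv_leBl [Au u0 + _]addrC.
Qed.

Theorem slater_duality (one : dual V) u0 v0 (eps : R) :
  lattice_unit one -> edom J u0 -> edom (H ^~ f) v0 -> 0 < eps ->
  Al u0 + eps *: one <=v v0 -> v0 <=v Au u0 - eps *: one ->
  exists mu, dual_solution Al Au f alpha J H mu /\
    forall u v, primal_solution Al Au f alpha J H u v ->
      [/\ primal_objective f alpha J H u v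
            = dual_objective Al Au f alpha J H mu,
          lagrange_multiplier Al Au f alpha J H mu u v &
          prod_dual mu (opB Al Au u - opE v) = 0].
Proof.
move=> one1 Ju0 Hv0 eps0 lo up; pose w0 := (u0, v0).
have Dw0 : D w0 by exact: domainE.
pose feas : set (dual U * dual V) := [set w | prod_le 0 (- gap w)].
have feasE w : feas w = prod_le (B w.1) (E w.2).
  by rewrite /feas /= /gap opprB prod_subr_ge0.
have slater z : `|z| <= eps -> prod_le 0 (z - gap w0) by exact: (slater_gap one1).
have feas0 : feas w0 by rewrite /feas /= -sub0r slater// normr0 ltW.
pose p := ereal_inf [set obj w | w in feas].
have p0 : (0 <= p)%E by apply/ereal_infP => _ [w _ <-]; exact: objective_ge0.
have p_le w : feas w -> (p <= obj w)%E by move=> fw; apply: ereal_inf_lbound; exists w.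
have [m pE] : exists m : R, p = m%:E.
  exists (fine p); rewrite fineK// ge0_fin_numE//.
  exact: le_lt_trans (p_le _ feas0) Dw0.
have [nu [nu0 m_le]] : exists nu : dual (dual V * dual V)%type,
    (forall z, prod_le 0 z -> 0 <= nu z) /\
    forall w, D w -> m <= fine (obj w) + nu (gap w).
  apply: (@slater_multiplier _ _ _ (fun z => prod_le 0 z) D (fine \o obj) gap w0 eps).
  - exact: prod_ge0D.
  - exact: prod_ge0Z.
  - move=> w w' t Dw Dw' t01; apply: le_lt_trans (objective_convex Dw Dw' t01) _.
    exact: ltry.
  - move=> w w' t Dw Dw' t01; rewrite -lee_fin objective_fineK ?objective_convex//.
    by apply: le_lt_trans (objective_convex Dw Dw' t01) _; exact: ltry.
  - move=> w w' t _ _ _; by rewrite gap_linear subrr /prod_le !lv_lexx.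
  - exact: Dw0.
  - exact: eps0.
  - exact: slater.
  - by move=> w Dw fw; rewrite -lee_fin -pE objective_fineK// p_le.
have [mu muE] := prod_dual_surj nu.
have mu0 : prod_le 0 mu by apply/prod_dual_ge0P => z; rewrite muE; exact: nu0.
have m_dual : (m%:E <= dual_objective Al Au f alpha J H mu)%E.
  by apply: dual_objective_ge => w Dw; rewrite muE m_le.
have dual_m mu' : prod_le 0 mu' -> (dual_objective Al Au f alpha J H mu' <= m%:E)%E.
  move=> mu'0; rewrite -pE; apply/ereal_infP => _ [w fw <-].
  apply: le_trans (dual_objective_le mu' w.1 w.2) _.
  rewrite -[leRHS]adde0 leeD2l// lee_fin -oppr_ge0 -linearN.
  by move/prod_dual_ge0P: mu'0; exact.
have dualE : dual_objective Al Au f alpha J H mu = m%:E.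
  by apply/le_anti; rewrite m_dual dual_m.
exists mu; split; first by split=> // mu' mu'0; rewrite dualE dual_m.
move=> u v [fuv uv_min].
have fw : feas (u, v) by rewrite feasE.
have objE : primal_objective f alpha J H u v = m%:E.
  apply/le_anti/andP; split; last by rewrite -pE; exact: p_le fw.
  rewrite -pE; apply/ereal_infP => _ [w + <-]; rewrite feasE; exact: uv_min.
have lagE : lagrangian Al Au f alpha J H mu u v
    = (m + prod_dual mu (opB Al Au u - opE v))%:E by rewrite EFinD -objE.
have gap0 : prod_dual mu (opB Al Au u - opE v) = 0.
  apply/le_anti/andP; split.
    by rewrite -oppr_ge0 -linearN; move/prod_dual_ge0P: mu0; exact.
  by have := dual_objective_le mu u v; rewrite dualE lagE lee_fin lerDl.
split=> //; first by rewrite dualE.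
by split=> // u' v'; rewrite lagE gap0 addr0 -dualE dual_objective_le.
Qed.

End Duality.

Theorem corollary2p7 (R : realType) (U V : banachLatticeType R)
    (Al Au : bop (dual U) (dual V)) (f : dual V) (alpha : R)
    (J : dual U -> \bar R) (H : dual V -> dual V -> \bar R) (one : dual V) :
  0 < alpha ->
  (forall u, 0 <= J u)%E -> eproper J -> econvex J -> weak_star_lsc J ->
  (forall v, 0 <= H v f)%E -> eproper (H ^~ f) -> econvex (H ^~ f) ->
  weak_star_lsc (H ^~ f) ->
  AM_space (dual V) -> lattice_unit one ->
  (exists u0 v0 (eps : R),
    [/\ edom J u0, edom (H ^~ f) v0, 0 < eps,
        Al u0 + eps *: one <=v v0 & v0 <=v Au u0 - eps *: one]) ->
  exists mu : dual (dual V) * dual (dual V),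
    dual_solution Al Au f alpha J H mu /\
    forall (u : dual U) (v : dual V), primal_solution Al Au f alpha J H u v ->
      [/\ primal_objective f alpha J H u v
            = dual_objective Al Au f alpha J H mu,
          lagrange_multiplier Al Au f alpha J H mu u v &
          prod_dual mu (opB Al Au u - opE v) = 0].
Proof.
move=> alpha0 J0 Jp Jc _ H0 Hp Hc _ _ one1 [u0 [v0 [eps [Ju0 Hv0 eps0 lo up]]]].
exact: (slater_duality alpha0 J0 Jp Jc H0 Hp Hc one1 Ju0 Hv0 eps0 lo up).
Qed.
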